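(* There is a class $S$ of scoring functions $s:\mathbb{R}^2\to\mathbb{R}$ such that, for each of the two fairness notions $\mathcal{F}\in\{\text{pairwise DP},\text{pairwise EO}\}$, there are (finite) datasets in $\mathbb{R}^2\times[4]\times\{0,1\}$ showing the following. 1. For every $K>0$ there is a dataset $\mathcal{D}$ such that the following holds. Consider procedure (A): choose $s\in S$ minimizing the number of label flips on $\mathcal{D}$ over all of $S$ (with no fairness requirement on $s$), and then choose thresholds that minimize the MAE on $\mathcal{D}$ under the constraint that the resulting predictor satisfies $\mathcal{F}$ on $\mathcal{D}$. Consider procedure (B): choose $s\in S$ minimizing the number of label flips on $\mathcal{D}$ among those $s\in S$ that satisfy $\mathcal{F}$ on $\mathcal{D}$ (at least one such $s$ exists), and then choose thresholds that minimize the MAE on $\mathcal{D}$ under the constraint that the resulting predictor satisfies $\mathcal{F}$ on $\mathcal{D}$. Then procedure (A) can result in a predictor $f_A$ with $\mathrm{MAE}(f_A;\mathcal{D})>K\cdot\mathrm{MAE}(f_B;\mathcal{D})$ for every predictor $f_B$ resulting from procedure (B). 2. There is a dataset $\mathcal{D}$ such that choosing $s\in S$ to minimize the number of label flips on $\mathcal{D}$ among those $s\in S$ that satisfy $\mathcal{F}$ on $\mathcal{D}$, and then choosing thresholds that minimize the MAE on $\mathcal{D}$ (without requiring that the resulting predictor satisfies $\mathcal{F}$), can result in a predictor $f$ with $\text{DP-viol}(f;\mathcal{D})=0.5$ if $\mathcal{F}$ is pairwise DP, respectively $\text{EO-viol}(f;\mathcal{D})=1$ if $\mathcal{F}$ is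 pairwise EO. In contrast, thresholds required to yield a predictor satisfying $\mathcal{F}$ on $\mathcal{D}$ always give $\text{DP-viol}=0$ (respectively $\text{EO-viol}=0$).
   Context: $[4]=\{1,2,3,4\}$. A dataset is a finite family $\mathcal{D}=((x_i,y_i,a_i))_{i=1}^n$ with $x_i\in\mathbb{R}^2$, label $y_i\in[4]$ and protected attribute $a_i\in\mathcal{A}=\{0,1\}$. Given a scoring function $s$ and thresholds $\theta_1\le\theta_2\le\theta_3$, the resulting predictor $f$ has $f(x)=i$ iff $s(x)\in(\theta_{i-1},\theta_i]$, with $\theta_0=-\infty$, $\theta_4=+\infty$. $\mathrm{MAE}(f;\mathcal{D})=\frac1n\sum_{i=1}^n|y_i-f(x_i)|$. The number of label flips of $s$ on $\mathcal{D}$ is the number of pairs of datapoints that $s$ puts in the wrong order, i.e. pairs $(i,j)$ with $y_i<y_j$ but $s(x_i)>s(x_j)$. For a function $g$ (a predictor or a scoring function), with $(x_1,y_1,a_1),(x_2,y_2,a_2)$ independent uniform samples from $\mathcal{D}$, $$\text{DP-viol}(g;\mathcal{D})=\max_{\tilde a,\hat a\in\mathcal{A}}\big|\mathbb{P}[g(x_1)>g(x_2)\mid a_1=\tilde a,a_2=\hat a]-\mathbb{P}[g(x_1)<g(x_2)\mid a_1=\tilde a,a_2=\hat a]\big|,$$ $$\text{EO-viol}(g;\mathcal{D})=\max_{\tilde a,\hat a\in\mathcal{A}}\big|\mathbb{P}[g(x_1)>g(x_2)\mid a_1=\tilde a,a_2=\hat a,y_1>y_2]-\mathbb{P}[g(x_1)<g(x_2)\mid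 a_1=\tilde a,a_2=\hat a,y_1<y_2]\big|.$$ $g$ satisfies pairwise DP (pairwise EO) on $\mathcal{D}$ if $\text{DP-viol}(g;\mathcal{D})=0$ ($\text{EO-viol}(g;\mathcal{D})=0$). *)

(* Defs.v *)
From mathcomp Require Import all_boot all_order all_algebra.
From mathcomp Require Import classical_sets reals constructive_ereal.

Set Implicit Arguments.
Unset Strict Implicit.
Unset Printing Implicit Defensive.

Import Order.TTheory GRing.Theory Num.Theory.
Local Open Scope ring_scope.

Definition label : Type := {i : nat | (1 <= i <= 4)%N}.
Definition nat_of_label (l : label) : nat := sval l.
Coercion nat_of_label : label >-> nat.

(* The protected attribute set {0, 1} is bool. *)
Record dataset (R : realType) := Dataset {
  data_size : nat;
  feature : 'I_data_size -> 'rV[R]_2;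
  target : 'I_data_size -> label;
  attr : 'I_data_size -> bool }.

Definition scoring (R : realType) := 'rV[R]_2 -> R.
Definition predictor (R : realType) := 'rV[R]_2 -> label.

Record thresholds (R : realType) := Thresholds {
  theta1 : R;
  theta2 : R;
  theta3 : R;
  theta12 : theta1 <= theta2;
  theta23 : theta2 <= theta3 }.

Definition theta (R : realType) (t : thresholds R) (i : nat) : \bar R :=
  match i with
  | 0%N => -oo%E
  | 1%N => (theta1 t)%:E
  | 2%N => (theta2 t)%:E
  | 3%N => (theta3 t)%:E
  | _ => +oo%E
  end.

Definition threshold_predictor (R : realType) (s : scoring R)
    (t : thresholds R) (f : predictor R) : Prop :=
  forall (x : 'rV[R]_2) (i : label),
    f x = i <-> (theta t i.-1 < (s x)%:E <= theta t i)%E.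

Definition mae (R : realType) (f : predictor R) (D : dataset R) : R :=
  (data_size D)%:R^-1 *
  \sum_(i < data_size D) `| (target i)%:R - (f (feature i))%:R |.

Definition label_flips (R : realType) (s : scoring R) (D : dataset R) : nat :=
  #|[set p : 'I_(data_size D) * 'I_(data_size D) |
      ((target p.1 < target p.2)%N && (s (feature p.1) > s (feature p.2)))]|.

(* Two independent uniform samples from D are a uniform element of
   'I_n * 'I_n, where n = data_size D; an event is a set of such pairs of indices. *)
Definition event (R : realType) (D : dataset R) :=
  {set 'I_(data_size D) * 'I_(data_size D)}.

Definition prob (R : realType) (D : dataset R) (E : event D) : R :=
  #|E|%:R / #|[set: 'I_(data_size D) * 'I_(data_size D)]|%:R.

(* Equal to 0 when C has probability 0; see viol_defined. *)
Definition cond_prob (R : realType) (D : dataset R) (E C : event D) : R :=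
  prob (E :&: C)%SET / prob C.

Section Events.
Variables (R : realType) (D : dataset R).

Definition attrs_are (a b : bool) : event D :=
  [set p | (attr p.1 == a) && (attr p.2 == b)].
Definition label_gt : event D := [set p | (target p.1 > target p.2)%N].
Definition label_lt : event D := [set p | (target p.1 < target p.2)%N].

Variables (d : Order.disp_t) (T : orderType d) (g : 'rV[R]_2 -> T).

Definition value_gt : event D :=
  [set p | (g (feature p.1) > g (feature p.2))%O].
Definition value_lt : event D :=
  [set p | (g (feature p.1) < g (feature p.2))%O].
End Events.

Inductive fairness := PairwiseDP | PairwiseEO.

(* The events conditioned upon in the first and in the second probability. *)
Definition cond_gt (F : fairness) (R : realType) (D : dataset R) (a b : bool) :
    event D :=
  match F with
  | PairwiseDP => attrs_are D a b
  | PairwiseEO => (attrs_are D a b :&: label_gt D)%SET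
  end.
Definition cond_lt (F : fairness) (R : realType) (D : dataset R) (a b : bool) :
    event D :=
  match F with
  | PairwiseDP => attrs_are D a b
  | PairwiseEO => (attrs_are D a b :&: label_lt D)%SET
  end.

(* DP-viol or EO-viol; the neutral element 0 of the maximum is harmless
   because the terms are nonnegative. *)
Definition viol (F : fairness) (R : realType) (d : Order.disp_t)
    (T : orderType d) (g : 'rV[R]_2 -> T) (D : dataset R) : R :=
  \big[Num.max/0]_(a : bool) \big[Num.max/0]_(b : bool)
    `| cond_prob (value_gt D g) (cond_gt F D a b)
       - cond_prob (value_lt D g) (cond_lt F D a b) |.

(* All the conditional probabilities occurring in viol make sense; in
   particular D is nonempty. *)
Definition viol_defined (F : fairness) (R : realType) (D : dataset R) : Prop :=
  forall a b : bool, prob (cond_gt F D a b) > 0 /\ prob (cond_lt F D a b) > 0.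

Definition viol_score (F : fairness) (R : realType) (s : scoring R)
  (D : dataset R) : R := viol F s D.
Definition viol_pred (F : fairness) (R : realType) (f : predictor R)
  (D : dataset R) : R := viol F (fun x => nat_of_label (f x)) D.

Definition fair_score (F : fairness) (R : realType) (D : dataset R)
  (s : scoring R) : Prop := viol_score F s D = 0.
Definition fair_pred (F : fairness) (R : realType) (D : dataset R)
  (f : predictor R) : Prop := viol_pred F f D = 0.

Definition minimizes (T : Type) (d : Order.disp_t) (U : porderType d)
    (h : T -> U) (A : set T) (x : T) : Prop :=
  A x /\ forall y, A y -> (h x <= h y)%O.

Local Open Scope classical_set_scope.

Section Procedures.
Variables (R : realType) (S : set (scoring R)) (F : fairness) (D : dataset R).

Definition min_flips : set (scoring R) :=
  minimizes (fun s => label_flips s D) S.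
Definition min_flips_fair : set (scoring R) :=
  minimizes (fun s => label_flips s D) (S `&` fair_score F D).

Definition threshold_predictors (s : scoring R) : set (predictor R) :=
  [set f | exists t, threshold_predictor s t f].

Definition min_mae (s : scoring R) : set (predictor R) :=
  minimizes (fun f => mae f D) (threshold_predictors s).
Definition min_mae_fair (s : scoring R) : set (predictor R) :=
  minimizes (fun f => mae f D) (threshold_predictors s `&` fair_pred F D).

(* Possible results; the suffixes tell which of the two steps, choice of the
   scoring function and choice of the thresholds, is constrained to be fair. *)
Definition result_thresholds_fair : set (predictor R) :=
  [set f | exists2 s, min_flips s & min_mae_fair s f].
Definition result_both_fair : set (predictor R) :=
  [set f | exists2 s, min_flips_fair s & min_mae_fair s f].
Definition result_score_fair : set (predictor R) :=
  [set f | exists2 s, min_flips_fair s & min_mae s f].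
End Procedures.

(* Main.v *)
(* Both parts use the points with (attribute, label) = (0, 1), (1, 2), (1, 1),
   (0, 2), and S consists of the two coordinates, so a dataset amounts to two
   arbitrary scorings of these four points.
   A predictor separating exactly the first point from the others violates
   pairwise DP by 1/2 and pairwise EO by 1.
   Part 1: the score (0, 1, 1, 1) has no label flips, since ties are not flips,
   but its only fair predictors are constant, with MAE at least 1/2. The label
   itself, as a score, is fair and flip-free and yields MAE 0, so one dataset
   serves every K.
   Part 2: the score (0, 1, 2, 3) is fair. Its one flip forces MAE at least 1/4,
   which is attained by separating the first point from the others. *)
Require Import Defs.
From mathcomp Require Import all_boot all_order all_algebra.
From mathcomp Require Import classical_sets reals constructive_ereal.
From mathcomp Require Import zify lra.

Set Implicit Arguments.
Unset Strict Implicit.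
Unset Printing Implicit Defensive.

Import Order.TTheory GRing.Theory Num.Theory.
Local Open Scope ring_scope.

(** * Threshold predictors: monotonicity and explicit form *)

Lemma theta_le (R : realType) (t : thresholds R) (i j : nat) :
  (i <= j)%N -> (theta t i <= theta t j)%E.
Proof.
have step k : (theta t k <= theta t k.+1)%E.
  by case: k => [|[|[|[|k]]]] /=; rewrite ?leNye ?leey ?lee_fin ?theta12 ?theta23.
move=> /subnK <-; elim: (j - i)%N => [|k IHk]; first by rewrite add0n.
by rewrite addSn (le_trans IHk).
Qed.

(** If [f y < f x], the upper threshold of [f y] is at most the lower threshold of [f x], which
    forces [s y < s x]. *)
Lemma threshold_predictor_mono (R : realType) (s : scoring R) (t : thresholds R)
    (f : predictor R) :
  threshold_predictor s t f -> forall x y, s x <= s y -> (f x <= f y)%N.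
Proof.
move=> fP x y sxy; rewrite leqNgt; apply/negP => fyx.
have /andP[ltx _] := (fP x (f x)).1 erefl.
have /andP[_ ley] := (fP y (f y)).1 erefl.
have le_theta : (theta t (f y) <= theta t (f x).-1)%E by apply: theta_le; lia.
have := lt_le_trans (le_lt_trans (le_trans ley le_theta) ltx).
by move=> /(_ (s y)%:E); rewrite lee_fin ltxx => /(_ sxy).
Qed.

Definition threshold_label (R : realType) (t : thresholds R) (r : R) : label :=
  if r <= theta1 t then exist _ 1%N isT else
  if r <= theta2 t then exist _ 2%N isT else
  if r <= theta3 t then exist _ 3%N isT else exist _ 4%N isT.

Lemma threshold_labelP (R : realType) (s : scoring R) (t : thresholds R) :
  threshold_predictor s t (fun x => threshold_label t (s x)).
Proof.
move=> x [i /= i14]; rewrite /threshold_label.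
have label_inj (m n : label) : nat_of_label m = nat_of_label n <-> m = n.
  by split=> [/val_inj|->].
rewrite -label_inj {label_inj} /=.
have t12 := theta12 t; have t23 := theta23 t.
case: i i14 => [|[|[|[|[|i]]]]] //= _;
  rewrite ?lte_fin ?lee_fin ?ltNyr ?ltry ?leey ?andbT /=;
  have [le1|lt1] := leP; try (have [le2|lt2] := leP);
  try (have [le3|lt3] := leP); (split=> [//|]);
  rewrite ?andbT ?andbF //= => ?; exfalso; lra.
Qed.

(** * Four-point datasets and probabilities as counts of index pairs *)

Definition point (R : realType) (k : 'I_2 -> nat -> nat) (i : nat) : 'rV[R]_2 :=
  \row_j (k j i)%:R.

(* The four combinations of attribute and label, in the order
   (0, 1), (1, 2), (1, 1), (0, 2). *)
Definition four_points (R : realType) (k : 'I_2 -> nat -> nat) : dataset R :=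
  @Dataset R 4 (fun i => point R k i)
    (fun i => if odd i then exist _ 2%N isT else exist _ 1%N isT)
    (fun i => (0 < i < 3)%N).

Definition coordinates (R : realType) : set (scoring R) :=
  [set s | exists j, s = fun x : 'rV[R]_2 => x ord0 j].
Arguments coordinates R : clear implicits.

(** Explicit lists make the counts evaluate by computation, unlike cardinals of finite sets. *)
Definition count_pairs (P : nat -> nat -> bool) : nat :=
  sumn [seq sumn [seq nat_of_bool (P i j) | j <- iota 0 4] | i <- iota 0 4].

Lemma card_pairs (A : {set 'I_4 * 'I_4}) (P : nat -> nat -> bool) :
  (forall i j, ((i, j) \in A) = P i j) -> #|A| = count_pairs P.
Proof.
move=> AP; rewrite -sum1_card big_mkcond /=.
rewrite (eq_bigr (fun p : 'I_4 * 'I_4 => nat_of_bool (P p.1 p.2))); last first.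
  by case=> i j _; rewrite AP; case: (P i j).
rewrite -(pair_bigA _ (fun i j : 'I_4 => nat_of_bool (P i j))) /=.
by rewrite !big_ord_recl !big_ord0.
Qed.

Lemma label_flips_four_points (R : realType) (k : 'I_2 -> nat -> nat) (j : 'I_2) :
  label_flips (fun x => x ord0 j) (four_points R k) =
  count_pairs (fun i i' => [&& ~~ odd i, odd i' & (k j i' < k j i)%N]).
Proof.
apply: card_pairs => i i'; rewrite inE /= !mxE ltr_nat.
by case: (odd i); case: (odd i').
Qed.

(** On indices, [0 < i < 3] is the attribute and [odd i] means label 2. Swapping both the pair and
    the groups turns [cond_gt] into [cond_lt], so one predicate serves both. *)
Definition pairs_cond (F : fairness) (a b : bool) (i j : nat) : bool :=
  [&& (0 < i < 3)%N == a, (0 < j < 3)%N == b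
    & if F is PairwiseEO then odd i && ~~ odd j else true].

(** The term of [viol] at groups [a], [b] for any function that orders the four points as [u]
    does. *)
Definition gap (R : realType) (F : fairness) (u : nat -> nat) (a b : bool) : R :=
  `|(count_pairs (fun i j => (u j < u i)%N && pairs_cond F a b i j))%:R /
      (count_pairs (pairs_cond F a b))%:R
    - (count_pairs (fun i j => (u i < u j)%N && pairs_cond F b a j i))%:R /
      (count_pairs (fun i j => pairs_cond F b a j i))%:R|.

Lemma probE (R : realType) (k : 'I_2 -> nat -> nat)
    (A : event (four_points R k)) P :
  (forall i j, ((i, j) \in A) = P (nat_of_ord i) (nat_of_ord j)) ->
  prob A = (count_pairs P)%:R / 16.
Proof.
by move=> AP; rewrite /prob (card_pairs AP) cardsT card_prod !card_ord.
Qed.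

Lemma mem_cond_gt (R : realType) (k : 'I_2 -> nat -> nat) F a b i j :
  ((i, j) \in cond_gt F (four_points R k) a b) = pairs_cond F a b i j.
Proof.
by case: F; rewrite /pairs_cond !inE /= ?andbT -?andbA //;
  case: (odd i); case: (odd j).
Qed.

Lemma mem_cond_lt (R : realType) (k : 'I_2 -> nat -> nat) F a b i j :
  ((i, j) \in cond_lt F (four_points R k) a b) = pairs_cond F b a j i.
Proof.
by case: F; rewrite /pairs_cond !inE /=; case: (odd i); case: (odd j);
  rewrite ?andbT ?andbF // andbC.
Qed.

Lemma viol_four_points (R : realType) (k : 'I_2 -> nat -> nat) F
    (d : Order.disp_t) (T : orderType d) (g : 'rV[R]_2 -> T) (u : nat -> nat) :
  (forall i j : 'I_4, (g (point R k i) < g (point R k j))%O = (u i < u j)%N) ->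
  viol F g (four_points R k) =
  \big[Num.max/0]_(a : bool) \big[Num.max/0]_(b : bool) gap R F u a b.
Proof.
move=> gu; apply: eq_bigr => a _; apply: eq_bigr => b _.
(* Conditioning cancels the common denominator 16, the number of index pairs. *)
have div16 (x y : R) : x / 16 / (y / 16) = x / y.
  by rewrite invfM invrK mulrCA divfK ?pnatr_eq0 // mulrC.
congr (`| _ - _ |); rewrite /cond_prob.
  by rewrite (probE (@mem_cond_gt _ _ _ _ _))
    (@probE _ _ _ (fun i j => (u j < u i)%N && pairs_cond F a b i j)) ?div16 //
    => i j; rewrite finset.in_setI mem_cond_gt inE gu.
by rewrite (@probE _ _ _ (fun i j => pairs_cond F b a j i) (@mem_cond_lt _ _ _ _ _))
    (@probE _ _ _ (fun i j => (u i < u j)%N && pairs_cond F b a j i)) ?div16 //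
    => i j; rewrite finset.in_setI mem_cond_lt inE gu.
Qed.

(** Each group contains a point of each label, so every conditioning event is nonempty. *)
Lemma viol_defined_four_points (R : realType) (k : 'I_2 -> nat -> nat) F :
  viol_defined F (four_points R k).
Proof.
move=> a b; rewrite (probE (@mem_cond_gt _ _ _ _ _)).
rewrite (@probE _ _ _ (fun i j => pairs_cond F b a j i) (@mem_cond_lt _ _ _ _ _)).
by case: F; case: a; case: b; split; rewrite divr_gt0 ?ltr0n.
Qed.

Lemma viol_four_points_eq (R : realType) (k : 'I_2 -> nat -> nat) F
    (d : Order.disp_t) (T : orderType d) (g : 'rV[R]_2 -> T) (u : nat -> nat)
    (c : R) :
  (forall i j : 'I_4, (g (point R k i) < g (point R k j))%O = (u i < u j)%N) ->
  0 <= c -> (forall a b, gap R F u a b = if a == b then 0 else c) ->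
  viol F g (four_points R k) = c.
Proof.
move=> gu c0 gapE; rewrite (viol_four_points _ gu); apply/le_anti/andP; split.
  apply: bigmax_le => // a _; apply: bigmax_le => // b _.
  by rewrite gapE; case: ifP.
(* The value [c] is reached at [a = false], [b = true]. *)
apply: le_trans (le_bigmax _ _ false); apply: le_trans (le_bigmax _ _ true).
by rewrite gapE.
Qed.

(** * Violations and errors for particular orderings *)

Definition step_viol (R : realType) (F : fairness) : R :=
  match F with PairwiseDP => 1 / 2 | PairwiseEO => 1 end.

Lemma step_viol_gt0 (R : realType) F : 0 < step_viol R F.
Proof. by case: F; rewrite /step_viol ?divr_gt0. Qed.

(** Within a group, swapping the pair equates the two probabilities. Across groups, under DP two of
    the four pairs are strict, both in the same direction; under EO each probability conditions on a
    single pair, and only one of these two pairs is strict. *)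
Lemma gap_step (R : realType) F (u : nat -> nat) a b :
  (u 0 < u 1)%N -> u 2 = u 1 -> u 3 = u 1 ->
  gap R F u a b = if a == b then 0 else step_viol R F.
Proof.
move=> u01 u21 u31.
have u10 : (u 1 < u 0)%N = false by rewrite ltnNge ltnW.
case: F; case: a; case: b;
  rewrite /gap /count_pairs /pairs_cond /= ?u21 ?u31 ?u01 ?u10 ?ltnn /=;
  rewrite !(add0n, addn0, addSn) ?mul0r ?subrr ?normr0 //
    ?subr0 ?sub0r ?normrN ger0_norm ?divr_ge0 // /step_viol;
  lra.
Qed.

Lemma gap_const (R : realType) F (u : nat -> nat) (m : nat) a b :
  (forall i, u i = m) -> gap R F u a b = 0.
Proof.
move=> um; case: F; case: a; case: b;
  rewrite /gap /count_pairs /pairs_cond /= ?um ?ltnn /=;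
  by rewrite !(add0n, addn0) ?mul0r subrr normr0.
Qed.

(** Each group has one even and one odd index: under DP each strict order occurs in one of four
    pairs, and under EO every conditioned pair is ordered correctly. *)
Lemma gap_odd (R : realType) F a b : gap R F odd a b = 0.
Proof.
by case: F; case: a; case: b; rewrite /gap /count_pairs /pairs_cond /=
  !(add0n, addn0) ?mul0r subrr normr0.
Qed.

(** Group 0 takes both ends of the order and group 1 the middle, which balances DP. The only
    misordered pair lies inside group 1, so it affects both EO probabilities alike. *)
Lemma gap_id (R : realType) F a b : gap R F id a b = 0.
Proof.
by case: F; case: a; case: b; rewrite /gap /count_pairs /pairs_cond /=
  !(add0n, addn0) ?mul0r subrr normr0.
Qed.

Lemma mae_four_points (R : realType) (k : 'I_2 -> nat -> nat) (f : predictor R)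
    (u : nat -> nat) :
  (forall i : 'I_4, nat_of_label (f (point R k i)) = u i) ->
  mae f (four_points R k) =
  (`|1 - (u 0)%:R| + `|2 - (u 1)%:R| + `|1 - (u 2)%:R| + `|2 - (u 3)%:R|) / 4.
Proof.
by move=> fu; rewrite /mae !big_ord_recl big_ord0 !fu /= addr0 !addrA mulrC.
Qed.

(** The errors are at least [b - 1] and [2 - a]. This bounds the cost of ranking a label 2 point no
    higher than a label 1 point. *)
Lemma swap_cost (R : realType) (a b : nat) :
  (a <= b)%N -> 1 <= `|1 - b%:R| + `|2 - a%:R| :> R.
Proof.
rewrite -(ler_nat R) => ab.
have := ler_norm (2 - a%:R : R); have := ler_norm (- (1 - b%:R) : R).
rewrite normrN; lra.
Qed.

Lemma coordinate_point (R : realType) (k : 'I_2 -> nat -> nat) (j : 'I_2) i :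
  point R k i ord0 j = (k j i)%:R.
Proof. by rewrite mxE. Qed.

Lemma coordinate_lt (R : realType) (k : 'I_2 -> nat -> nat) (j : 'I_2) i i' :
  (point R k i ord0 j < point R k i' ord0 j) = (k j i < k j i')%N.
Proof. by rewrite !coordinate_point ltr_nat. Qed.

Lemma viol_step (R : realType) (k : 'I_2 -> nat -> nat) F
    (d : Order.disp_t) (T : orderType d) (g : 'rV[R]_2 -> T) (u : nat -> nat) :
  (forall i j : 'I_4, (g (point R k i) < g (point R k j))%O = (u i < u j)%N) ->
  (u 0 < u 1)%N -> u 2 = u 1 -> u 3 = u 1 ->
  viol F g (four_points R k) = step_viol R F.
Proof.
move=> gu u01 u21 u31; apply: (viol_four_points_eq gu).
  by rewrite ltW ?step_viol_gt0.
by move=> a b; apply: gap_step.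
Qed.

Lemma viol_eq0 (R : realType) (k : 'I_2 -> nat -> nat) F
    (d : Order.disp_t) (T : orderType d) (g : 'rV[R]_2 -> T) (u : nat -> nat) :
  (forall i j : 'I_4, (g (point R k i) < g (point R k j))%O = (u i < u j)%N) ->
  (forall a b, gap R F u a b = 0) -> viol F g (four_points R k) = 0.
Proof.
by move=> gu gu0; apply: (viol_four_points_eq gu) => // a b; rewrite gu0 if_same.
Qed.

(** * First dataset: a flip-free unfair score beside a flip-free fair one *)

Definition step_or_odd (j : 'I_2) (i : nat) : nat :=
  if j == ord0 then (0 < i)%N else odd i.

Section StepOrOdd.
Context (R : realType) (F : fairness).
Local Notation D := (four_points R step_or_odd).

Lemma label_flips_step_or_odd (s : scoring R) :
  coordinates R s -> label_flips s D = 0.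
Proof.
move=> [j ->]; rewrite label_flips_four_points /count_pairs /step_or_odd.
by case: (j == ord0).
Qed.

Lemma fair_step_or_odd (s : scoring R) :
  coordinates R s -> fair_score F D s -> s = fun x => x ord0 (lift ord0 ord0).
Proof.
move=> [j ->]; case: (unliftP ord0 j) => [i ->|->]; first by rewrite (ord1 i).
rewrite /fair_score /viol_score (viol_step _ (@coordinate_lt R step_or_odd ord0)) //.
by move=> /eqP; rewrite gt_eqF ?step_viol_gt0.
Qed.

Lemma fair_odd : fair_score F D (fun x => x ord0 (lift ord0 ord0)).
Proof. 
apply: (viol_eq0 (u := odd)) => [i j|a b]; last exact: gap_odd.
exact: coordinate_lt.
Qed.

Lemma mae_step_ge (t : thresholds R) (f : predictor R) :
  threshold_predictor (fun x => x ord0 ord0) t f -> fair_pred F D f ->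
  1 / 2 <= mae f D.
Proof.
move=> /threshold_predictor_mono fmono fair.
pose u i := nat_of_label (f (point R step_or_odd i)).
have le_u i j : (step_or_odd ord0 i <= step_or_odd ord0 j)%N -> (u i <= u j)%N.
  by move=> ij; apply: fmono; rewrite !coordinate_point ler_nat.
have eq_u i : (0 < i)%N -> u i = u 1%N.
  by case: i => // i _; apply/eqP; rewrite eqn_leq !le_u.
(* Either the first point is separated, contradicting fairness, or [f] is constant on the
   dataset. *)
have [u01|u10] := ltnP (u 0%N) (u 1%N).
  have gu (i j : 'I_4) : (u i < u j)%O = (u i < u j)%N by [].
  move: fair; rewrite /fair_pred /viol_pred.
  rewrite (viol_step _ gu u01 (eq_u 2 isT) (eq_u 3 isT)).
  by move=> /eqP; rewrite gt_eqF ?step_viol_gt0.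
rewrite (mae_four_points (u := u)) //.
(* The disjoint pairs of points 1, 2 and 3, 0 each cost 1, out of four points. *)
have := @swap_cost R (u 1%N) (u 2%N); rewrite le_u // => /(_ isT).
have := @swap_cost R (u 3%N) (u 0%N); rewrite [u 3%N]eq_u // u10 => /(_ isT).
lra.
Qed.

(** All scores are at most 1, so every data point gets label 1. *)
Let t111 : thresholds R := Thresholds (lexx 1) (lexx 1).

Lemma constant_result :
  exists f, result_thresholds_fair (coordinates R) F D f /\ mae f D = 1 / 2.
Proof.
set f : predictor R := fun x => threshold_label t111 (x ord0 ord0).
have f1 i : nat_of_label (f (point R step_or_odd i)) = 1%N.
  by rewrite /f coordinate_point /threshold_label /= lern1 leq_b1.
have maef : mae f D = 1 / 2.
  rewrite (mae_four_points (u := fun=> 1%N)) => [|i]; last exact: f1.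
  by rewrite subrr normr0 ger0_norm; lra.
exists f; split=> //; exists (fun x => x ord0 ord0).
  split; first by exists ord0.
  by move=> s Ss; rewrite label_flips_step_or_odd //; exists ord0.
split=> [|g [[t gt]]]; last by rewrite maef => /mae_step_ge; apply; exact: gt.
split; first by exists t111; apply: threshold_labelP.
apply: (viol_eq0 (u := fun=> 1%N)) => [i j|a b]; first by rewrite !f1.
exact: (@gap_const R F _ 1).
Qed.

(** Scores 0 and 1 become labels 1 and 2, the true ones for the second coordinate. *)
Let t011 : thresholds R := Thresholds ler01 (lexx 1).

Lemma mae_both_fair f :
  result_both_fair (coordinates R) F D f -> mae f D <= 0.
Proof.
move=> [s [[Ss fair_s] _] [_ min_f]].
rewrite {s Ss fair_s}(fair_step_or_odd Ss fair_s) in min_f.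
set g : predictor R := fun x => threshold_label t011 (x ord0 (lift ord0 ord0)).
have gE i : nat_of_label (g (point R step_or_odd i)) = (odd i).+1.
  rewrite /g coordinate_point /threshold_label /= lern0 lern1 leq_b1.
  by rewrite /step_or_odd /=; case: (odd i).
have maeg : mae g D = 0.
  rewrite (mae_four_points (u := fun i => (odd i).+1)) => [|i]; last exact: gE.
  by rewrite /= !subrr !normr0 !addr0 mul0r.
rewrite -maeg; apply: min_f; split.
  by exists t011; apply: threshold_labelP.
apply: (viol_eq0 (u := odd)) => [i j|a b]; last exact: gap_odd.
by rewrite !gE ltEnat /= ltnS.
Qed.

End StepOrOdd.

(** * Second dataset: both coordinates give the same fair score, with one flip *)

Definition index_score (j : 'I_2) (i : nat) : nat := i.

Section IndexScore.
Context (R : realType) (F : fairness).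
Local Notation D := (four_points R index_score).

(** Score 0 gets label 1 and scores 1 to 3 get label 2, so only point 2 is mislabelled. *)
Let t033 : thresholds R := Thresholds (ler0n R 3) (lexx 3).

Lemma label_flips_index (s : scoring R) :
  coordinates R s -> label_flips s D = 1%N.
Proof. by move=> [j ->]; rewrite label_flips_four_points. Qed.

Lemma mae_index_ge (s : scoring R) (t : thresholds R) (f : predictor R) :
  coordinates R s -> threshold_predictor s t f -> 1 / 4 <= mae f D.
Proof.
move=> [j ->] /threshold_predictor_mono fmono.
rewrite (@mae_four_points R index_score f
  (fun i => nat_of_label (f (point R index_score i)))) //.
(* Points 1 and 2, with labels 2 and 1, form the flip. *)
have := @swap_cost R (f (point R index_score 1)) (f (point R index_score 2)).
rewrite fmono ?coordinate_point ?ler_nat // => /(_ isT).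
have := normr_ge0 (1 - (f (point R index_score 0))%:R : R).
have := normr_ge0 (2 - (f (point R index_score 3))%:R : R).
lra.
Qed.

Lemma unfair_result :
  exists f, result_score_fair (coordinates R) F D f /\
            viol_pred F f D = step_viol R F.
Proof.
set s : scoring R := fun x => x ord0 ord0.
have Ss : coordinates R s by exists ord0.
set f : predictor R := fun x => threshold_label t033 (s x).
have fE (i : 'I_4) : nat_of_label (f (point R index_score i)) = (0 < i)%N.+1.
  rewrite /f /s coordinate_point /threshold_label /= lern0 ler_nat /index_score.
  by case: i => [[|[|[|[|i]]]]].
exists f; split; last first.
  apply: (@viol_step _ _ _ _ _ _ (fun i => (0 < i)%N)) => // i j.
  by rewrite !fE ltEnat /= ltnS.
exists s.
  split=> [|s' [Ss' _]]; last by rewrite !label_flips_index.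
  split=> //; apply: (viol_eq0 (u := id)) => [i j|a b]; last exact: gap_id.
  exact: coordinate_lt.
split=> [|g [t gt]]; first by exists t033; apply: threshold_labelP.
apply: le_trans (mae_index_ge Ss gt).
rewrite (mae_four_points (u := fun i => (0 < i)%N.+1)) => [|i]; last exact: fE.
by rewrite /= !subrr !normr0 -normrN opprB ger0_norm; lra.
Qed.

End IndexScore.

Theorem lemma1 (R : realType) :
  exists S : set (scoring R), forall F : fairness,
    (forall K : R, 0 < K ->
       exists D : dataset R,
         [/\ viol_defined F D,
             (exists s : scoring R, S s /\ fair_score F D s)
           & exists fA : predictor R,
               result_thresholds_fair S F D fA /\
               forall fB : predictor R, result_both_fair S F D fB ->
                 mae fA D > K * mae fB D]) /\
    (exists D : dataset R,
       [/\ viol_defined F D,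
           (exists f : predictor R,
              result_score_fair S F D f /\
              viol_pred F f D =
                match F with PairwiseDP => 1 / 2 | PairwiseEO => 1 end)
         & forall (s : scoring R) (t : thresholds R) (f : predictor R),
             S s -> threshold_predictor s t f -> fair_pred F D f ->
             viol_pred F f D = 0]).
Proof.
exists (coordinates R) => F; split=> [K K0|].
  exists (four_points R step_or_odd); split.
  - exact: viol_defined_four_points.
  - exists (fun x => x ord0 (lift ord0 ord0)).
    by split; [exists (lift ord0 ord0) | exact: fair_odd].
  - have [f [fA maef]] := constant_result R F; exists f; split=> // g /mae_both_fair.
    by rewrite maef => /(mulr_ge0_le0 (ltW K0)) /le_lt_trans; apply; rewrite divr_gt0.
(* The last clause is closed here: [fair_pred] unfolds to its conclusion. *)
exists (four_points R index_score); split=> //.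
- exact: viol_defined_four_points.
- exact: unfair_result.
Qed.
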